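(* Let $N=1$, so $\mathbb{S}_1=\{1,\dots,\eta\}$. Then the $1$-partition formulation (P1)--(P5) is equivalent to the big-M formulation (M1)--(M3): for every $(x,y,\sigma)\in X\times[0,\infty)\times[0,1]$, there exists $z_1^b\in\mathbb{R}$ such that $(x,y,\sigma,z_1^b)$ satisfies (P1)--(P5) if and only if $(x,y,1-\sigma)$ satisfies (M1)--(M3). In particular the same equivalence holds when $\sigma$ is restricted to $\{0,1\}$.
   Context: Setting: a ReLU node $y=\max(0,w^T x+b)$ with fixed weights $w\in\mathbb{R}^\eta$, $b\in\mathbb{R}$, and bounded inputs $x\in X=\prod_{i=1}^\eta[\underline{x}_i,\bar{x}_i]$ with $\underline{x}_i\le\bar{x}_i$. Let $\mathit{LB}^0,\mathit{UB}^0\in\mathbb{R}$ be valid bounds of the preactivation: $\mathit{LB}^0\le w^T x+b\le\mathit{UB}^0$ for all $x\in X$. Big-M formulation, in variables $x\in X$, $y\in[0,\infty)$ and $s$ (binary, or in $[0,1]$ in the continuous relaxation), for a triple $(x,y,s)$: (M1) $y\ge w^T x+b$; (M2) $y\le w^T x+b-(1-s)\mathit{LB}^0$; (M3) $y\le s\,\mathit{UB}^0$. $N$-partition formulation: $\{1,\dots,\eta\}$ is partitioned into pairwise disjoint nonempty sets $\mathbb{S}_1,\dots,\mathbb{S}_N$; the variables are $x\in X$, $y\in[0,\infty)$, $\sigma$ (binary, or in $[0,1]$ in the continuous relaxation), $z_1^b,\dots,z_N^b\in\mathbb{R}$; the constraints are (P1) $\sum_{n=1}^N\big(\sum_{i\in\mathbb{S}_n}w_i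 x_i-z_n^b\big)+\sigma b\le 0$; (P2) $\sum_{n=1}^N z_n^b+(1-\sigma)b\ge 0$; (P3) $y=\sum_{n=1}^N z_n^b+(1-\sigma)b$; (P4) $\sigma\,\mathit{LB}_n^a\le\sum_{i\in\mathbb{S}_n}w_i x_i-z_n^b\le\sigma\,\mathit{UB}_n^a$ for $n=1,\dots,N$; (P5) $(1-\sigma)\,\mathit{LB}_n^b\le z_n^b\le(1-\sigma)\,\mathit{UB}_n^b$ for $n=1,\dots,N$. For $N=1$ the bounds on $z_1=w^T x$ are those corresponding to the preactivation bounds: $\mathit{LB}_1^a=\mathit{LB}_1^b=\mathit{LB}^0-b$ and $\mathit{UB}_1^a=\mathit{UB}_1^b=\mathit{UB}^0-b$. *)

(* Defs.v *)
From HB Require Import structures.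
From mathcomp Require Import all_boot all_order all_algebra.
From mathcomp Require Import reals.
Set Implicit Arguments.
Unset Strict Implicit.
Unset Printing Implicit Defensive.
Import Order.TTheory GRing.Theory Num.Theory.
Local Open Scope ring_scope.

Definition in_box (R : realType) (eta : nat) (xl xu x : 'cV[R]_eta) : Prop :=
  forall i : 'I_eta, xl i 0 <= x i 0 <= xu i 0.

Definition preactivation (R : realType) (eta : nat) (w : 'cV[R]_eta) (b : R)
    (x : 'cV[R]_eta) : R :=
  (w^T *m x) 0 0 + b.

Definition valid_preactivation_bounds (R : realType) (eta : nat)
    (w : 'cV[R]_eta) (b : R) (xl xu : 'cV[R]_eta) (LB0 UB0 : R) : Prop :=
  forall x : 'cV[R]_eta, in_box xl xu x ->
    LB0 <= preactivation w b x <= UB0.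

(* The domains of x, y and of the binary or relaxed variable (s, resp. sigma)
   are not part of the two constraint systems below. *)
Definition bigM_constraints (R : realType) (eta : nat) (w : 'cV[R]_eta) (b : R)
    (LB0 UB0 : R) (x : 'cV[R]_eta) (y s : R) : Prop :=
  [/\ preactivation w b x <= y,
      y <= preactivation w b x - (1 - s) * LB0
    & y <= s * UB0].

(* Stated on the indexed family rather than through [partition] on the set of
   its blocks, which would allow S m = S n for m != n. *)
Definition is_index_partition (eta N : nat) (S : 'I_N -> {set 'I_eta}) : Prop :=
  [/\ forall n : 'I_N, S n != set0,
      forall m n : 'I_N, m != n -> [disjoint S m & S n]
    & \bigcup_(n < N) S n = [set: 'I_eta]].

Definition partition_constraints (R : realType) (eta N : nat)
    (S : 'I_N -> {set 'I_eta}) (w : 'cV[R]_eta) (b : R)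
    (LBa UBa LBb UBb : 'I_N -> R)
    (x : 'cV[R]_eta) (y sigma : R) (zb : 'I_N -> R) : Prop :=
  [/\ \sum_(n < N) (\sum_(i in S n) w i 0 * x i 0 - zb n) + sigma * b <= 0,
      0 <= \sum_(n < N) zb n + (1 - sigma) * b,
      y = \sum_(n < N) zb n + (1 - sigma) * b,
      forall n : 'I_N,
        sigma * LBa n <= \sum_(i in S n) w i 0 * x i 0 - zb n <= sigma * UBa n
    & forall n : 'I_N,
        (1 - sigma) * LBb n <= zb n <= (1 - sigma) * UBb n].

(* Main.v *)
Require Import Defs.
From HB Require Import structures.
From mathcomp Require Import all_boot all_order all_algebra.
From mathcomp Require Import reals.
From mathcomp Require Import lra.
Set Implicit Arguments.
Unset Strict Implicit.
Unset Printing Implicit Defensive.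
Import Order.TTheory GRing.Theory Num.Theory.
Local Open Scope ring_scope.

(** With a single block, the equation defining [y] leaves no freedom in the
    auxiliary variable: [z = y - (1 - sigma) * b].  Substitute this value and
    write [p] for the preactivation at [x].  All terms in [b] cancel, and the
    partition system becomes [p <= y], [0 <= y],
    [sigma * LB0 <= p - y <= sigma * UB0] and
    [(1 - sigma) * LB0 <= y <= (1 - sigma) * UB0].  The inequality [p <= y],
    the lower bound on [p - y] and the upper bound on [y] are exactly the
    big-M system for [s = 1 - sigma].  The upper bound on [p - y] and the lower
    bound on [y] have no big-M counterpart, but they follow from that system,
    [0 <= y] and the validity of the bounds on [p]
    ([partition_upper_bound], [partition_lower_bound]).  The binary case is an
    instance of the relaxed one. *)

(** In an indexed partition with one block, the block is everything, so the
    block sum is the whole scalar product. *)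
Lemma sum_single_block (R : realType) (eta : nat) (w x : 'cV[R]_eta) (b : R)
    (S : 'I_1 -> {set 'I_eta}) (n : 'I_1) :
  is_index_partition S ->
  \sum_(i in S n) w i 0 * x i 0 = preactivation w b x - b.
Proof.
case=> _ _; rewrite big_ord1 (ord1 n) => ->.
rewrite /preactivation addrK mxE.
by apply: eq_big => i; [rewrite in_setT | rewrite mxE].
Qed.

(** If [LB <= 0] this is weaker than [0 <= y]; if [LB > 0] then
    [(1 - sigma) * LB <= LB <= p <= y]. *)
Lemma partition_lower_bound (R : realDomainType) (LB p y sigma : R) :
  0 <= sigma <= 1 -> 0 <= y -> LB <= p -> p <= y -> (1 - sigma) * LB <= y.
Proof.
move=> /andP[s0 s1] y0 hL hp; case: (lerP LB 0) => hLB.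
  by apply: le_trans y0; rewrite mulr_ge0_le0 // subr_ge0.
by have := mulr_ge0 s0 (ltW hLB); lra.
Qed.

(** If [UB >= 0] then [p - y <= 0 <= sigma * UB].  If [UB < 0], the node is
    always inactive: [0 <= y <= (1 - sigma) * UB] forces [sigma = 1], and the
    claim reduces to [p - y <= p <= UB]. *)
Lemma partition_upper_bound (R : realDomainType) (UB p y sigma : R) :
  0 <= sigma <= 1 -> 0 <= y -> p <= UB -> p <= y -> y <= (1 - sigma) * UB ->
  p - y <= sigma * UB.
Proof.
move=> /andP[s0 s1] y0 hU hp hy; case: (lerP 0 UB) => hUB.
  by have := mulr_ge0 s0 hUB; lra.
have sigma1 : sigma = 1.
  apply/le_anti; rewrite s1 /= -subr_le0 -(nmulr_lge0 _ hUB).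
  exact: le_trans hy.
by rewrite sigma1 mul1r; lra.
Qed.

Lemma one_partition_equiv_bigM (R : realType) (eta : nat) (w : 'cV[R]_eta)
    (b LB UB : R) (S : 'I_1 -> {set 'I_eta}) (x : 'cV[R]_eta) (y sigma : R) :
  is_index_partition S -> LB <= preactivation w b x <= UB ->
  0 <= y -> 0 <= sigma <= 1 ->
  (exists z : R,
     partition_constraints S w b
       (fun=> LB - b) (fun=> UB - b) (fun=> LB - b) (fun=> UB - b)
       x y sigma (fun=> z))
  <-> bigM_constraints w b LB UB x y (1 - sigma).
Proof.
move=> hS /andP[hL hU] y0 hs; split.
  case=> z; rewrite /partition_constraints !big_ord1 (sum_single_block w x b _ hS).
  case=> P1 P2 P3 /(_ ord0) P4 /(_ ord0) P5; move: P4 P5.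
  rewrite (sum_single_block w x b _ hS) => /andP[P4l P4u] /andP[P5l P5u].
  by split; lra.
case=> M1 M2 M3.
have Pl := partition_lower_bound hs y0 hL M1.
have Pu := partition_upper_bound hs y0 hU M1 M3.
exists (y - (1 - sigma) * b).
rewrite /partition_constraints !big_ord1 (sum_single_block w x b _ hS).
split; [lra|lra|lra| |] => n; rewrite ?(sum_single_block w x b _ hS);
  by apply/andP; split; lra.
Qed.

Theorem proposition2 (R : realType) (eta : nat) (w : 'cV[R]_eta) (b : R)
    (xl xu : 'cV[R]_eta) (LB0 UB0 : R) (S : 'I_1 -> {set 'I_eta})
    (hbox : forall i : 'I_eta, xl i 0 <= xu i 0)
    (hbounds : valid_preactivation_bounds w b xl xu LB0 UB0)
    (hS : is_index_partition S) :
  (forall (x : 'cV[R]_eta) (y sigma : R),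
     in_box xl xu x -> 0 <= y -> 0 <= sigma <= 1 ->
     ((exists z1b : R,
         partition_constraints S w b
           (fun=> LB0 - b) (fun=> UB0 - b) (fun=> LB0 - b) (fun=> UB0 - b)
           x y sigma (fun=> z1b))
      <-> bigM_constraints w b LB0 UB0 x y (1 - sigma)))
  /\
  (forall (x : 'cV[R]_eta) (y sigma : R),
     in_box xl xu x -> 0 <= y -> sigma = 0 \/ sigma = 1 ->
     ((exists z1b : R,
         partition_constraints S w b
           (fun=> LB0 - b) (fun=> UB0 - b) (fun=> LB0 - b) (fun=> UB0 - b)
           x y sigma (fun=> z1b))
      <-> bigM_constraints w b LB0 UB0 x y (1 - sigma))).
Proof.
split=> x y sigma hx y0 hsigma; apply: one_partition_equiv_bigM => //;
  try exact: hbounds.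
by case: hsigma => ->; rewrite lexx ler01.
Qed.
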